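(* Let $p,q:[a,\infty)\to(0,\infty)$ be continuous, $a\ge 0$, and consider the equation (A): $(p(t)x')'=q(t)x$. Assume that $\int_a^\infty\frac{dt}{p(t)}<\infty$ and $\int_a^\infty q(t)\,dt<\infty$. Put $\pi(t)=\int_t^\infty\frac{ds}{p(s)}$ and $\rho(t)=\int_t^\infty q(s)\,ds$. Then all solutions of (A) are divided into the three classes consisting of moderate solutions of the types III(i), III(ii) and III(iii). These classes are represented, respectively, by solutions $x_1(t)$, $x_2(t)$ and $x_3(t)$ of (A) (that is, there exist solutions $x_1,x_2,x_3$ of types III(i), III(ii), III(iii), respectively) which are reproduced from global solutions of (R1) (or (R2)) and have the following asymptotic behavior as $t\to\infty$: $$x_1(t)\sim 1,\quad Dx_1(t)\sim 1,$$ $$x_2(t)\sim \pi(t),\quad Dx_2(t)\sim -1,$$ $$x_3(t)\sim 1,\quad Dx_3(t)\sim -\rho(t).$$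
   Context: Solutions of (A) are nontrivial real solutions defined on some interval $[T,\infty)$, $T\ge a$. The quasi-derivative of $x$ is $Dx(t)=p(t)x'(t)$. For every solution $x$ of (A) the limits $x(\infty)=\lim_{t\to\infty}x(t)$ and $Dx(\infty)=\lim_{t\to\infty}Dx(t)$ exist in the extended reals; the pair $(x(\infty),Dx(\infty))$ is the terminal state of $x$. Types of terminal states (the solutions having them are called moderate): III(i): $0<|x(\infty)|<\infty$ and $0<|Dx(\infty)|<\infty$; III(ii): $x(\infty)=0$ and $0<|Dx(\infty)|<\infty$; III(iii): $0<|x(\infty)|<\infty$ and $Dx(\infty)=0$. The Riccati equations associated with (A) are (R1) $u'=q(t)-\frac{u^2}{p(t)}$ and (R2) $v'=\frac1{p(t)}-q(t)v^2$. A global solution is a solution existing on some interval $[T,\infty)$. A solution $x$ of (A) is reproduced from a global solution $u$ of (R1) if, up to a nonzero constant factor, for all large $t$, $x(t)=\exp\bigl(\int_T^t\frac{u(s)}{p(s)}ds\bigr)$ or $x(t)=\exp\bigl(-\int_t^\infty\frac{u(s)}{p(s)}ds\bigr)$ (according as the improper integral diverges or converges), or $x(t)=\frac1{u(t)}\exp\bigl(\int_T^t\frac{q(s)}{u(s)}ds\bigr)$ or $x(t)=\frac1{u(t)}\exp\bigl(-\int_t^\infty\frac{q(s)}{u(s)}ds\bigr)$ (with $u\ne0$, same convention). It is reproduced from a global solution $v\neq 0$ of (R2) if, up to a nonzero constant factor, $x(t)=\exp\bigl(\int_T^t\frac{ds}{p(s)v(s)}\bigr)$ or $x(t)=\exp\bigl(-\int_t^\infty\frac{ds}{p(s)v(s)}\bigr)$,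 or $x(t)=v(t)\exp\bigl(\int_T^tq(s)v(s)ds\bigr)$ or $x(t)=v(t)\exp\bigl(-\int_t^\infty q(s)v(s)ds\bigr)$ (same convention). $f(t)\sim g(t)$ as $t\to\infty$ means $\lim_{t\to\infty}f(t)/g(t)=1$. *)

(* Defs.v *)
From Stdlib Require Import Reals.
From Coquelicot Require Import Coquelicot.
Open Scope R_scope.

(** A function on [[T,+oo)] is represented by a total function [R -> R] whose
    values to the left of [T] are irrelevant. *)

(** Coquelicot's [is_derive] with the variable restricted to [[T,+oo)]: the
    two-sided derivative at [t > T], the right derivative at [t = T]. *)
Definition is_derive_from (T : R) (f : R -> R) (t l : R) : Prop :=
  filterdiff f (within (fun s => T <= s) (locally t)) (fun h => scal h l).

Definition improper_converges (f : R -> R) (t : R) : Prop :=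
  ex_RInt_gen f (at_point t) (Rbar_locally p_infty).

Definition tail_integral (f : R -> R) (t : R) : R :=
  RInt_gen f (at_point t) (Rbar_locally p_infty).

Definition asymptotic (f g : R -> R) : Prop :=
  is_lim (fun t => f t / g t) p_infty 1.

(** [(p x')' = q x] on [[T,+oo)]. *)
Definition solves_A (p q : R -> R) (T : R) (x : R -> R) : Prop :=
  exists x' : R -> R,
    forall t, T <= t ->
      is_derive_from T x t (x' t) /\
      is_derive_from T (fun s => p s * x' s) t (q t * x t).

Definition solution_A (a : R) (p q x : R -> R) : Prop :=
  exists T, a <= T /\ solves_A p q T x /\ (exists t, T <= t /\ x t <> 0).

(** Only used as [t] tends to infinity, where [Derive x] is the derivative of a
    solution [x] even if [x] is not differentiable at the endpoint [T]. *)
Definition quasi_derivative (p x : R -> R) (t : R) : R := p t * Derive x t.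

Definition terminal_state (p x : R -> R) (X DX : Rbar) : Prop :=
  is_lim x p_infty X /\ is_lim (quasi_derivative p x) p_infty DX.

Definition finite_nonzero (l : Rbar) : Prop :=
  Rbar_lt 0 (Rbar_abs l) /\ Rbar_lt (Rbar_abs l) p_infty.

Definition type_III_i (p x : R -> R) : Prop :=
  exists X DX, terminal_state p x X DX /\ finite_nonzero X /\ finite_nonzero DX.

Definition type_III_ii (p x : R -> R) : Prop :=
  exists X DX, terminal_state p x X DX /\ X = 0 /\ finite_nonzero DX.

Definition type_III_iii (p x : R -> R) : Prop :=
  exists X DX, terminal_state p x X DX /\ finite_nonzero X /\ DX = 0.

Definition solves_R1 (p q : R -> R) (T : R) (u : R -> R) : Prop :=
  forall t, T <= t -> is_derive_from T u t (q t - (u t) ^ 2 / p t).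

Definition solves_R2 (p q : R -> R) (T : R) (v : R -> R) : Prop :=
  forall t, T <= t -> is_derive_from T v t (1 / p t - q t * (v t) ^ 2).

Definition is_exp_integral (f : R -> R) (T : R) (E : R -> R) : Prop :=
  (~ improper_converges f T /\
     forall t, T <= t -> E t = exp (RInt f T t)) \/
  (improper_converges f T /\
     forall t, T <= t -> E t = exp (- tail_integral f t)).

Definition proportional_at_infinity (x y : R -> R) : Prop :=
  exists c, c <> 0 /\ Rbar_locally p_infty (fun t => x t = c * y t).

Definition reproduced_from_R1 (a : R) (p q x : R -> R) : Prop :=
  exists T u E, a <= T /\ solves_R1 p q T u /\
    ((is_exp_integral (fun s => u s / p s) T E /\
      proportional_at_infinity x E) \/
     ((forall t, T <= t -> u t <> 0) /\
      is_exp_integral (fun s => q s / u s) T E /\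
      proportional_at_infinity x (fun t => 1 / u t * E t))).

Definition reproduced_from_R2 (a : R) (p q x : R -> R) : Prop :=
  exists T v E, a <= T /\ solves_R2 p q T v /\
    (forall t, T <= t -> v t <> 0) /\
    ((is_exp_integral (fun s => 1 / (p s * v s)) T E /\
      proportional_at_infinity x E) \/
     (is_exp_integral (fun s => q s * v s) T E /\
      proportional_at_infinity x (fun t => v t * E t))).

(* Main.v *)
Require Import Defs.
From Stdlib Require Import Reals Lra Lia.
From Coquelicot Require Import Coquelicot.
Open Scope R_scope.

(** Write [y = p x'] and [r = 1 / p]. The equation becomes the system [x' = r y],
    [y' = q x], which is symmetric in [(r, x)] and [(q, y)], and whose
    coefficients are both integrable at infinity. Infinity then behaves like an
    ordinary point: solutions are parametrized by their terminal values.

    The terminal value problem [x(oo) = alpha], [y(oo) = beta] is equivalent to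
    [x(t) = alpha - int_t^oo r y], [y(t) = beta - int_t^oo q x]. Where both tails
    of the coefficients are at most [1 / 2], Picard iteration contracts by a
    factor [1 / 2] in the uniform norm; this gives [terminal_value_problem].
    Constancy of the Wronskian shows that any other solution is, near infinity, a
    combination of the solutions with terminal values [(1, 0)] and [(0, 1)], so it
    has finite terminal values too ([solution_has_limits]). They cannot both
    vanish unless the solution is trivial on its whole interval, because
    [(x^2 + y^2) exp (- int_t^oo (r + q))] is nondecreasing
    ([zero_terminal_state]). The three remaining possibilities for a pair of
    terminal values are the three types.

    The representatives have terminal values [(1, 1)], [(0, -1)] and [(1, 0)].
    If [w' = r z] with [w -> 0] and [z -> l], then [w ~ - l int_t^oo r]
    ([vanishing_quotient]); with [(w, z) = (x, y)], and with the roles exchanged,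
    this gives [x2 ~ pi] and [Dx3 ~ - rho]. For the Riccati equations,
    [u = y / x] solves the first one and [u / p] is the logarithmic derivative of
    [x]; [v = x / y] solves the second one and [q v] is the logarithmic derivative
    of [y]. A function with a finite nonzero limit is recovered from its
    logarithmic derivative by a convergent integral
    ([is_exp_integral_log_derivative]). The first and third representatives are
    thus recovered from [u], while for the second, where [x] tends to [0], it is
    [y] that is recovered and [x = v y]. *)

(** * Finite limits and eventual properties *)

Lemma eventually_ge (T : R) : Rbar_locally p_infty (fun t => T <= t).
Proof. exists T; intros t Ht; lra. Qed.

Lemma is_lim_mult_finite (f g : R -> R) (x : Rbar) (l m : R) :
  is_lim f x l -> is_lim g x m -> is_lim (fun t => f t * g t) x (l * m).
Proof. intros Hf Hg; exact (is_lim_mult f g x l m Hf Hg I). Qed.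

Lemma is_lim_div_finite (f g : R -> R) (x : Rbar) (l m : R) :
  is_lim f x l -> is_lim g x m -> m <> 0 ->
  is_lim (fun t => f t / g t) x (l / m).
Proof.
  intros Hf Hg Hm; apply is_lim_mult_finite; [exact Hf|].
  apply (is_lim_inv g x m Hg); intros E; apply Hm; congruence.
Qed.

Lemma is_lim_within (f : R -> R) (x : Rbar) (l eps : R) :
  is_lim f x l -> 0 < eps -> Rbar_locally' x (fun t => Rabs (f t - l) < eps).
Proof.
  intros Hf He; apply is_lim_spec in Hf; exact (Hf (mkposreal eps He)).
Qed.

Lemma is_lim_eventually_pos (f : R -> R) (l : R) :
  is_lim f p_infty l -> 0 < l -> Rbar_locally p_infty (fun t => 0 < f t).
Proof.
  intros Hf Hl; generalize (is_lim_within f p_infty l l Hf Hl).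
  apply filter_imp; intros t Ht; apply Rabs_lt_between in Ht; lra.
Qed.

(** * Functions dominated by an integrable weight *)

(** [P t] is the integral of [r] over [[t,+oo)], encoded as the primitive of
    [- r] that vanishes at infinity; no improper integral is then needed in the
    estimates. *)
Definition integrable_weight (r P : R -> R) : Prop :=
  (forall t, continuous r t) /\ (forall t, 0 <= r t) /\
  (forall t, is_derive P t (- r t)) /\ is_lim P p_infty 0.

Lemma nondecreasing_from (T : R) (F f : R -> R) (s t : R) :
  (forall t, T <= t -> is_derive F t (f t)) ->
  (forall t, T <= t -> 0 <= f t) ->
  T <= s -> s <= t -> F s <= F t.
Proof.
  intros HF Hf Hs Hst.
  destruct (MVT_gen F s t f) as [c [Hc E]]; rewrite ?Rmin_left, ?Rmax_right in * by lra.
  - intros x Hx; apply HF; lra.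
  - intros x Hx; apply derivable_continuous_pt; exists (f x).
    apply is_derive_Reals, HF; lra.
  - assert (0 <= f c * (t - s)) by (apply Rmult_le_pos; [apply Hf|]; lra); lra.
Qed.

Lemma dominated_increment (T C : R) (F f r P : R -> R) (s t : R) :
  integrable_weight r P ->
  (forall t, T <= t -> is_derive F t (f t)) ->
  (forall t, T <= t -> Rabs (f t) <= C * r t) ->
  T <= s -> s <= t -> Rabs (F s - F t) <= C * P s - C * P t.
Proof.
  intros [_ [_ [HP _]]] HF Hf Hs Hst.
  assert (H1 : - C * P s - F s <= - C * P t - F t).
  { apply (nondecreasing_from T (fun t => - C * P t - F t) (fun t => C * r t - f t));
      auto; intros x Hx.
    - evar_last.
      + apply @is_derive_minus; [apply is_derive_scal, HP | apply HF, Hx].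
      + unfold minus, plus, opp; simpl; ring.
    - generalize (Hf x Hx); intros H; apply Rabs_le_between in H; lra. }
  assert (H2 : - C * P s + F s <= - C * P t + F t).
  { apply (nondecreasing_from T (fun t => - C * P t + F t) (fun t => C * r t + f t));
      auto; intros x Hx.
    - evar_last.
      + apply @is_derive_plus; [apply is_derive_scal, HP | apply HF, Hx].
      + unfold plus; simpl; ring.
    - generalize (Hf x Hx); intros H; apply Rabs_le_between in H; lra. }
  apply Rabs_le; lra.
Qed.

(** The estimate behind both the contraction and the asymptotic formulas; it is
    the limit of [dominated_increment] as the right endpoint tends to infinity. *)
Lemma dominated_tail (T C l : R) (F f r P : R -> R) (t : R) :
  integrable_weight r P ->
  (forall t, T <= t -> is_derive F t (f t)) ->
  (forall t, T <= t -> Rabs (f t) <= C * r t) ->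
  is_lim F p_infty l -> T <= t -> Rabs (F t - l) <= C * P t.
Proof.
  intros HrP HF Hf Hl Ht.
  assert (H := is_lim_le_loc (fun s => Rabs (F t - F s)) (fun s => C * P t - C * P s)
    p_infty (Rabs (F t - l)) (C * P t - C * 0)).
  simpl in H; replace (C * P t) with (C * P t - C * 0) by ring; apply H.
  - exists t; intros s Hs; eapply (dominated_increment T C F f r P); eauto; lra.
  - apply (is_lim_Rabs (fun s => F t - F s) p_infty (F t - l)).
    apply is_lim_minus'; [apply is_lim_const | exact Hl].
  - apply is_lim_minus'; [apply is_lim_const |].
    apply (is_lim_scal_l P C p_infty 0), HrP.
Qed.

Lemma dominated_ex_lim (T C : R) (F f r P : R -> R) :
  integrable_weight r P ->
  (forall t, T <= t -> is_derive F t (f t)) ->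
  (forall t, T <= t -> Rabs (f t) <= C * r t) ->
  exists l : R, is_lim F p_infty l.
Proof.
  intros HrP HF Hf.
  destruct (proj1 (filterlim_locally_cauchy (F := Rbar_locally p_infty) F)) as [l Hl];
    [| exists l; exact Hl].
  intros eps.
  assert (HP : is_lim (fun t => C * P t) p_infty (C * 0))
    by apply (is_lim_scal_l P C p_infty 0), HrP.
  exists (fun t => T <= t /\ Rabs (C * P t - C * 0) < eps / 2); split.
  - apply filter_and; [apply eventually_ge|].
    apply (is_lim_within (fun t => C * P t) p_infty (C * 0) (eps / 2) HP).
    destruct eps; simpl; lra.
  - intros u v [Hu Hu'] [Hv Hv'].
    apply Rabs_lt_between in Hu'; apply Rabs_lt_between in Hv'.
    change (Rabs (F v - F u) < eps).
    destruct (Rle_dec u v) as [h|h].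
    + rewrite Rabs_minus_sym; eapply Rle_lt_trans;
        [eapply (dominated_increment T C F f r P); eauto | lra].
    + eapply Rle_lt_trans;
        [eapply (dominated_increment T C F f r P); eauto | ]; lra.
Qed.

Lemma weight_tail_nonneg (r P : R -> R) (t : R) : integrable_weight r P -> 0 <= P t.
Proof.
  intros HrP.
  assert (H : Rabs (0 - 0) <= 1 * P t).
  { apply (dominated_tail t 1 0 (fun _ => 0) (fun _ => 0) r P t HrP); try lra.
    - intros; apply @is_derive_const.
    - intros x _; rewrite Rabs_R0; generalize (proj1 (proj2 HrP) x); lra.
    - apply is_lim_const. }
  generalize (Rabs_pos (0 - 0)); lra.
Qed.

Lemma weight_tail_pos (r P : R -> R) (t : R) :
  integrable_weight r P -> (forall s, 0 < r s) -> 0 < P t.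
Proof.
  intros HrP Hr.
  destruct (MVT_gen P t (t + 1) (fun s => - r s)) as [c [_ E]].
  - intros x _; apply HrP.
  - intros x _; apply derivable_continuous_pt; exists (- r x).
    apply is_derive_Reals, HrP.
  - generalize (Hr c) (weight_tail_nonneg r P (t + 1) HrP); lra.
Qed.

(** A form of l'Hopital's rule: [w + l P] has derivative [r (z - l)], which is
    eventually dominated by [eps r], so that [|w + l P| <= eps P]. *)
Lemma vanishing_quotient (T l : R) (w z r P : R -> R) :
  integrable_weight r P -> (forall t, 0 < r t) ->
  (forall t, T <= t -> is_derive w t (r t * z t)) ->
  is_lim z p_infty l -> is_lim w p_infty 0 ->
  is_lim (fun t => w t / P t) p_infty (- l).
Proof.
  intros HrP Hr Hw Hz Hw0.
  apply is_lim_spec; intros [eps He]; simpl.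
  assert (Hz' := is_lim_within z p_infty l (eps / 2) Hz ltac:(lra)).
  destruct (filter_and _ _ (eventually_ge T) Hz') as [M HM].
  exists M; intros t Ht.
  assert (HP := weight_tail_pos r P t HrP Hr).
  assert (H : Rabs ((w t + l * P t) - 0) <= eps / 2 * P t).
  { apply (dominated_tail t (eps / 2) 0 (fun t => w t + l * P t)
             (fun t => r t * (z t - l)) r P t HrP); [| | | lra].
    - intros s Hs; evar_last.
      + apply @is_derive_plus; [apply Hw, HM; lra | apply is_derive_scal, HrP].
      + unfold plus; simpl; ring.
    - intros s Hs; rewrite Rabs_mult, (Rabs_pos_eq (r s)) by (left; apply Hr).
      rewrite Rmult_comm; apply Rmult_le_compat_r; [left; apply Hr|].
      left; apply HM; lra.
    - replace 0 with (0 + l * 0) by ring.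
      apply is_lim_plus'; [exact Hw0|].
      apply (is_lim_scal_l P l p_infty 0), HrP. }
  replace (w t / P t - - l) with ((w t + l * P t - 0) / P t) by (field; lra).
  unfold Rdiv; rewrite Rabs_mult, Rabs_inv, (Rabs_pos_eq (P t)) by lra.
  apply (Rmult_lt_reg_r (P t)); [exact HP|].
  rewrite Rmult_assoc, Rinv_l, Rmult_1_r by lra.
  eapply Rle_lt_trans; [exact H|]; apply Rmult_lt_compat_r; lra.
Qed.

(** * Solutions with prescribed limits at infinity *)

(** The first order form of the equation, with [r = 1 / p] and [y] the
    quasi-derivative of [x]. It is invariant under exchanging [(r, x)] with
    [(q, y)]. *)
Definition solves_system (r q : R -> R) (T : R) (x y : R -> R) : Prop :=
  forall t, T <= t -> is_derive x t (r t * y t) /\ is_derive y t (q t * x t).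

Definition vanishing_primitive (f : R -> R) (t : R) : R :=
  RInt f 0 t - real (Lim (RInt f 0) p_infty).

Lemma vanishing_primitive_spec (T C : R) (f r P : R -> R) :
  integrable_weight r P -> (forall t, continuous f t) ->
  (forall t, T <= t -> Rabs (f t) <= C * r t) ->
  (forall t, is_derive (vanishing_primitive f) t (f t)) /\
  is_lim (vanishing_primitive f) p_infty 0.
Proof.
  intros HrP Hc Hf.
  assert (HI : forall t, is_derive (RInt f 0) t (f t)).
  { intros t; apply (is_derive_RInt f (RInt f 0) 0 t); [|apply Hc].
    apply filter_forall; intros s; apply (@RInt_correct R_CompleteNormedModule).
    apply (@ex_RInt_continuous R_CompleteNormedModule); intros; apply Hc. }
  destruct (dominated_ex_lim T C (RInt f 0) f r P HrP (fun t _ => HI t) Hf) as [l Hl].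
  split.
  - intros t; unfold vanishing_primitive; evar_last.
    + apply @is_derive_minus; [apply HI | apply @is_derive_const].
    + unfold minus, plus, opp, zero; simpl; ring.
  - unfold vanishing_primitive; rewrite (is_lim_unique _ _ _ Hl); simpl.
    replace (Finite 0) with (Finite (l - l)) by (f_equal; ring).
    apply is_lim_minus'; [exact Hl | apply is_lim_const].
Qed.

Lemma geometric_uniform_limit (f : nat -> R -> R) (M : R) :
  (forall n t, continuous (f n) t) ->
  (forall n t, Rabs (f (S n) t - f n t) <= M * (1 / 2) ^ n) ->
  exists g : R -> R, (forall t, continuous g t) /\
    forall n t, Rabs (f n t - g t) <= 2 * M * (1 / 2) ^ n.
Proof.
  intros Hc Hf.
  assert (HM : 0 <= M).
  { generalize (Hf 0%nat 0) (Rabs_pos (f 1%nat 0 - f 0%nat 0)); simpl; lra. }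
  assert (Hk : forall n k t, Rabs (f n t - f (n + k)%nat t)
                 <= 2 * M * (1 / 2) ^ n - 2 * M * (1 / 2) ^ (n + k)).
  { intros n k t; induction k as [|k IH].
    - rewrite Nat.add_0_r, !Rminus_diag, Rabs_R0; lra.
    - replace (n + S k)%nat with (S (n + k)) by lia.
      generalize (Hf (n + k)%nat t); intros H.
      rewrite Rabs_minus_sym in H.
      replace (f n t - f (S (n + k)) t)
        with ((f n t - f (n + k)%nat t) + (f (n + k)%nat t - f (S (n + k)) t)) by ring.
      eapply Rle_trans; [apply Rabs_triang|]; simpl; lra. }
  assert (Hpow : is_lim_seq (fun n => 2 * M * (1 / 2) ^ n) 0).
  { replace (Finite 0) with (Rbar_mult (2 * M) 0) by (simpl; f_equal; ring).
    apply is_lim_seq_scal_l, is_lim_seq_geom; rewrite Rabs_pos_eq; lra. }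
  assert (Hnn : forall n, 0 <= 2 * M * (1 / 2) ^ n).
  { intros n; apply Rmult_le_pos; [lra | apply pow_le; lra]. }
  assert (Hg : forall t, exists l : R, is_lim_seq (fun n => f n t) l).
  { intros t; apply ex_lim_seq_cauchy_corr; intros eps.
    apply is_lim_seq_spec in Hpow; destruct (Hpow eps) as [N HN].
    assert (Hlt : forall n m, (N <= n)%nat -> (n <= m)%nat -> Rabs (f n t - f m t) < eps).
    { intros n m Hn Hm; generalize (Hk n (m - n)%nat t).
      replace (n + (m - n))%nat with m by lia; intros H.
      generalize (HN n Hn) (Hnn m); rewrite Rminus_0_r, Rabs_pos_eq by apply Hnn; lra. }
    exists N; intros n m Hn Hm; destruct (Nat.le_ge_cases n m) as [h|h].
    - apply Hlt; auto.
    - rewrite Rabs_minus_sym; apply Hlt; auto. }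
  set (g := fun t => real (Lim_seq (fun n => f n t))).
  assert (Hfg : forall n t, Rabs (f n t - g t) <= 2 * M * (1 / 2) ^ n).
  { intros n t; destruct (Hg t) as [l Hl].
    unfold g; rewrite (is_lim_seq_unique _ _ Hl); simpl.
    apply (is_lim_seq_le (fun k => Rabs (f n t - f (k + n)%nat t))
             (fun _ => 2 * M * (1 / 2) ^ n)
             (Finite (Rabs (f n t - l))) (Finite (2 * M * (1 / 2) ^ n))).
    - intros k; generalize (Hk n k t) (Hnn (n + k)%nat).
      rewrite (Nat.add_comm k n); lra.
    - apply (is_lim_seq_abs _ (Finite (f n t - l))), is_lim_seq_minus';
        [apply is_lim_seq_const|].
      apply (is_lim_seq_incr_n (fun k => f k t)), Hl.
    - apply is_lim_seq_const. }
  exists g; split; [|exact Hfg].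
  intros t; apply continuity_pt_filterlim.
  apply (CVU_continuity f g t (mkposreal 1 Rlt_0_1)).
  - intros eps He; apply is_lim_seq_spec in Hpow.
    destruct (Hpow (mkposreal eps He)) as [N HN]; exists N; intros n y Hn _.
    generalize (HN n Hn); rewrite Rminus_0_r, Rabs_pos_eq by apply Hnn; simpl.
    rewrite Rabs_minus_sym; generalize (Hfg n y); lra.
  - intros n y _; apply continuity_pt_filterlim, Hc.
  - unfold Boule; rewrite Rminus_diag, Rabs_R0; simpl; lra.
Qed.

Lemma continuous_Rmax_l (a t : R) : continuous (fun s => Rmax a s) t.
Proof.
  apply filterlim_locally; intros eps; exists eps; intros s Hs.
  change (Rabs (s - t) < eps) in Hs; change (Rabs (Rmax a s - Rmax a t) < eps).
  revert Hs; unfold Rmax, Rabs; repeat destruct Rle_dec; repeat destruct Rcase_abs; lra.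
Qed.

Lemma weight_tail_eventually_small (r P : R -> R) :
  integrable_weight r P -> exists T, forall t, T <= t -> P t <= 1 / 2.
Proof.
  intros HrP.
  destruct (is_lim_within P p_infty 0 (1 / 2) (proj2 (proj2 (proj2 HrP))) ltac:(lra))
    as [M HM].
  exists (M + 1); intros t Ht; generalize (HM t ltac:(lra)); intros H.
  apply Rabs_lt_between in H; lra.
Qed.

(** One coordinate of the integral equation
    [x t = alpha - int_t^oo r y], [y t = beta - int_t^oo q x]. The argument is
    clamped to [[T,+oo)], where the tails of the weights are small, so that the
    estimates hold on the whole line. *)
Definition integral_step (r : R -> R) (T alpha : R) (f : R -> R) (t : R) : R :=
  alpha + vanishing_primitive (fun s => r s * f s) (Rmax T t).

Lemma vanishing_primitive_mult_spec (B : R) (f r P : R -> R) :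
  integrable_weight r P ->
  (forall t, continuous f t) -> (forall t, Rabs (f t) <= B) ->
  (forall t, is_derive (vanishing_primitive (fun s => r s * f s)) t (r t * f t)) /\
  is_lim (vanishing_primitive (fun s => r s * f s)) p_infty 0.
Proof.
  intros HrP Hc Hf.
  apply (vanishing_primitive_spec 0 B (fun s => r s * f s) r P HrP).
  - intros t; apply (continuous_mult r f); [apply HrP | apply Hc].
  - intros t _; rewrite Rabs_mult, Rabs_pos_eq by apply HrP.
    rewrite Rmult_comm; apply Rmult_le_compat_r; [apply HrP | apply Hf].
Qed.

Lemma integral_step_contraction (T alpha B B' D : R) (f g r P : R -> R) (t : R) :
  integrable_weight r P -> (forall t, T <= t -> P t <= 1 / 2) ->
  (forall t, continuous f t) -> (forall t, Rabs (f t) <= B) ->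
  (forall t, continuous g t) -> (forall t, Rabs (g t) <= B') ->
  (forall t, Rabs (f t - g t) <= D) ->
  Rabs (integral_step r T alpha f t - integral_step r T alpha g t) <= D / 2.
Proof.
  intros HrP HP Hfc Hf Hgc Hg Hfg.
  destruct (vanishing_primitive_mult_spec B f r P HrP Hfc Hf) as [F1 F2].
  destruct (vanishing_primitive_mult_spec B' g r P HrP Hgc Hg) as [G1 G2].
  unfold integral_step; set (s := Rmax T t).
  assert (Hs : T <= s) by apply Rmax_l.
  set (F := vanishing_primitive (fun s => r s * f s)) in *.
  set (G := vanishing_primitive (fun s => r s * g s)) in *.
  assert (H : Rabs ((F s - G s) - 0) <= D * P s).
  { apply (dominated_tail T D 0 (fun s => F s - G s) (fun t => r t * (f t - g t)) r P s HrP);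
      [| | |exact Hs].
    - intros u _; evar_last; [apply @is_derive_minus; auto|].
      unfold minus, plus, opp; simpl; ring.
    - intros u _; rewrite Rabs_mult, Rabs_pos_eq by apply HrP.
      rewrite Rmult_comm; apply Rmult_le_compat_r; [apply HrP | apply Hfg].
    - replace (Finite 0) with (Finite (0 - 0)) by (f_equal; ring).
      apply is_lim_minus'; assumption. }
  replace (alpha + F s - (alpha + G s)) with (F s - G s - 0) by ring.
  eapply Rle_trans; [exact H|].
  replace (D / 2) with (D * (1 / 2)) by field.
  apply Rmult_le_compat_l; [|apply HP, Hs].
  eapply Rle_trans; [apply Rabs_pos | apply (Hfg 0)].
Qed.

Lemma integral_step_bounded (T alpha B : R) (f r P : R -> R) :
  integrable_weight r P -> (forall t, T <= t -> P t <= 1 / 2) ->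
  (forall t, continuous f t) -> (forall t, Rabs (f t) <= B) ->
  (forall t, continuous (integral_step r T alpha f) t) /\
  (forall t, Rabs (integral_step r T alpha f t - alpha) <= B / 2).
Proof.
  intros HrP HP Hc Hf.
  destruct (vanishing_primitive_mult_spec B f r P HrP Hc Hf) as [F1 F2].
  split; intros t.
  - apply (continuous_plus (fun _ => alpha)); [apply continuous_const|].
    apply (continuous_comp (fun t => Rmax T t) (vanishing_primitive _));
      [apply continuous_Rmax_l|].
    apply @ex_derive_continuous; eexists; apply F1.
  - unfold integral_step; set (s := Rmax T t).
    assert (Hs : T <= s) by apply Rmax_l.
    set (F := vanishing_primitive (fun s => r s * f s)) in *.
    replace (alpha + F s - alpha) with (F s - 0) by ring.
    apply Rle_trans with (B * P s).
    + apply (dominated_tail T B 0 F (fun t => r t * f t) r P s HrP); auto.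
      intros u _; rewrite Rabs_mult, Rabs_pos_eq by apply HrP.
      rewrite Rmult_comm; apply Rmult_le_compat_r; [apply HrP | apply Hf].
    + replace (B / 2) with (B * (1 / 2)) by field.
      apply Rmult_le_compat_l; [|apply HP, Hs].
      eapply Rle_trans; [apply Rabs_pos | apply (Hf 0)].
Qed.

Fixpoint picard (r q : R -> R) (T alpha beta : R) (n : nat) : (R -> R) * (R -> R) :=
  match n with
  | O => (fun _ => alpha, fun _ => beta)
  | S n => (integral_step r T alpha (snd (picard r q T alpha beta n)),
            integral_step q T beta (fst (picard r q T alpha beta n)))
  end.

(** With [M = |alpha| + |beta|], the ball of radius [2 M] is invariant, since a
    step moves away from [alpha] or [beta] by at most half the radius. *)
Lemma picard_bounded (r q P Q : R -> R) (T alpha beta : R) :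
  integrable_weight r P -> integrable_weight q Q ->
  (forall t, T <= t -> P t <= 1 / 2) -> (forall t, T <= t -> Q t <= 1 / 2) ->
  let M := Rabs alpha + Rabs beta in
  forall n,
    ((forall t, continuous (fst (picard r q T alpha beta n)) t) /\
     (forall t, Rabs (fst (picard r q T alpha beta n) t) <= 2 * M)) /\
    ((forall t, continuous (snd (picard r q T alpha beta n)) t) /\
     (forall t, Rabs (snd (picard r q T alpha beta n) t) <= 2 * M)).
Proof.
  intros HrP HqQ HP HQ M n.
  assert (Ha := Rabs_pos alpha); assert (Hb := Rabs_pos beta).
  induction n as [|n [[X1 X2] [Y1 Y2]]]; cbn [picard fst snd].
  - repeat split; intros t; try apply continuous_const; unfold M; lra.
  - destruct (integral_step_bounded T alpha (2 * M) _ r P HrP HP Y1 Y2) as [U1 U2].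
    destruct (integral_step_bounded T beta (2 * M) _ q Q HqQ HQ X1 X2) as [V1 V2].
    repeat split; auto; intros t.
    + generalize (U2 t) (Rabs_triang_inv (integral_step r T alpha
        (snd (picard r q T alpha beta n)) t) alpha); unfold M; lra.
    + generalize (V2 t) (Rabs_triang_inv (integral_step q T beta
        (fst (picard r q T alpha beta n)) t) beta); unfold M; lra.
Qed.

Lemma picard_cauchy (r q P Q : R -> R) (T alpha beta : R) :
  integrable_weight r P -> integrable_weight q Q ->
  (forall t, T <= t -> P t <= 1 / 2) -> (forall t, T <= t -> Q t <= 1 / 2) ->
  let M := Rabs alpha + Rabs beta in
  forall n t,
    Rabs (fst (picard r q T alpha beta (S n)) t - fst (picard r q T alpha beta n) t)
      <= M * (1 / 2) ^ n /\
    Rabs (snd (picard r q T alpha beta (S n)) t - snd (picard r q T alpha beta n) t)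
      <= M * (1 / 2) ^ n.
Proof.
  intros HrP HqQ HP HQ M n.
  assert (Ha := Rabs_pos alpha); assert (Hb := Rabs_pos beta).
  assert (Hbd := picard_bounded r q P Q T alpha beta HrP HqQ HP HQ).
  cbv zeta in Hbd; fold M in Hbd.
  induction n as [|n IH]; intros t.
  - destruct (integral_step_bounded T alpha M (fun _ => beta) r P HrP HP) as [_ U2].
    { intros; apply continuous_const. }
    { intros _; unfold M; lra. }
    destruct (integral_step_bounded T beta M (fun _ => alpha) q Q HqQ HQ) as [_ V2].
    { intros; apply continuous_const. }
    { intros _; unfold M; lra. }
    cbn [picard fst snd pow]; generalize (U2 t) (V2 t); unfold M in *; lra.
  - replace (M * (1 / 2) ^ S n) with (M * (1 / 2) ^ n / 2) by (simpl; field).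
    destruct (Hbd n) as [[X1 X2] [Y1 Y2]]; destruct (Hbd (S n)) as [[X3 X4] [Y3 Y4]].
    split.
    + exact (integral_step_contraction T alpha _ _ _ _ _ r P t HrP HP Y3 Y4 Y1 Y2
               (fun t => proj2 (IH t))).
    + exact (integral_step_contraction T beta _ _ _ _ _ q Q t HqQ HQ X3 X4 X1 X2
               (fun t => proj1 (IH t))).
Qed.

Lemma Rabs_le_geometric (c z : R) : (forall n, Rabs z <= c * (1 / 2) ^ n) -> z = 0.
Proof.
  intros H; destruct (Req_dec z 0) as [E|E]; [exact E|exfalso].
  apply Rabs_pos_lt in E.
  assert (L : is_lim_seq (fun n => c * (1 / 2) ^ n) 0).
  { replace (Finite 0) with (Rbar_mult c 0) by (simpl; f_equal; ring).
    apply is_lim_seq_scal_l, is_lim_seq_geom; rewrite Rabs_pos_eq; lra. }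
  assert (K := is_lim_seq_le (fun _ => Rabs z) _ (Finite (Rabs z)) 0 H
                 (is_lim_seq_const _) L); simpl in K; lra.
Qed.

(** The uniform limits of the iterates satisfy the integral equation exactly; by
    the symmetry of the system one coordinate suffices. *)
Lemma integral_step_fixpoint (T alpha M : R) (u v : nat -> R -> R) (x y r P : R -> R) :
  integrable_weight r P -> (forall t, T <= t -> P t <= 1 / 2) ->
  (forall n, u (S n) = integral_step r T alpha (v n)) ->
  (forall n t, continuous (v n) t) -> (forall n t, Rabs (v n t) <= M) ->
  (forall t, continuous y t) ->
  (forall n t, Rabs (u n t - x t) <= M * (1 / 2) ^ n) ->
  (forall n t, Rabs (v n t - y t) <= M * (1 / 2) ^ n) ->
  (forall t, Rabs (y t) <= 2 * M) /\ forall t, x t = integral_step r T alpha y t.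
Proof.
  intros HrP HP Huv Hvc Hvb Hyc Hux Hvy.
  assert (Hyb : forall t, Rabs (y t) <= 2 * M).
  { intros t; generalize (Hvy 0%nat t) (Hvb 0%nat t) (Rabs_triang_inv (y t) (v 0%nat t)).
    rewrite (Rabs_minus_sym (y t)); simpl; lra. }
  split; [exact Hyb|]; intros t.
  apply Rminus_diag_uniq, (Rabs_le_geometric M); intros n.
  assert (H1 := integral_step_contraction T alpha _ _ _ (v n) y r P t HrP HP
                  (Hvc n) (Hvb n) Hyc Hyb (Hvy n)).
  rewrite <- Huv in H1; assert (H2 := Hux (S n) t); rewrite Rabs_minus_sym in H2.
  replace (x t - integral_step r T alpha y t)
    with ((x t - u (S n) t) + (u (S n) t - integral_step r T alpha y t)) by ring.
  eapply Rle_trans; [apply Rabs_triang|]; simpl in H2; lra.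
Qed.

(** The integral equation from infinity is a contraction as soon as the tails of
    both weights are at most [1 / 2]; this solves the terminal value problem. *)
Lemma terminal_value_problem (r q P Q : R -> R) (alpha beta T0 : R) :
  integrable_weight r P -> integrable_weight q Q ->
  exists T x y, T0 <= T /\ solves_system r q T x y /\
    is_lim x p_infty alpha /\ is_lim y p_infty beta.
Proof.
  intros HrP HqQ.
  destruct (weight_tail_eventually_small r P HrP) as [T1 HP1].
  destruct (weight_tail_eventually_small q Q HqQ) as [T2 HQ2].
  set (T := Rmax T0 (Rmax T1 T2)).
  assert (HT : T0 <= T /\ T1 <= T /\ T2 <= T).
  { unfold T; repeat split; [apply Rmax_l | |];
      (eapply Rle_trans; [|apply Rmax_r]); [apply Rmax_l | apply Rmax_r]. }
  assert (HP : forall t, T <= t -> P t <= 1 / 2) by (intros; apply HP1; lra).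
  assert (HQ : forall t, T <= t -> Q t <= 1 / 2) by (intros; apply HQ2; lra).
  set (M := Rabs alpha + Rabs beta).
  set (u := fun n => fst (picard r q T alpha beta n)).
  set (v := fun n => snd (picard r q T alpha beta n)).
  assert (Hbd := picard_bounded r q P Q T alpha beta HrP HqQ HP HQ).
  assert (Hcau := picard_cauchy r q P Q T alpha beta HrP HqQ HP HQ).
  destruct (geometric_uniform_limit u M) as [x [Hxc Hx]].
  { intros n; apply Hbd. }
  { intros n t; apply Hcau. }
  destruct (geometric_uniform_limit v M) as [y [Hyc Hy]].
  { intros n; apply Hbd. }
  { intros n t; apply Hcau. }
  destruct (integral_step_fixpoint T alpha (2 * M) u v x y r P) as [Hyb Ex]; auto;
    try (intros n; apply Hbd).
  destruct (integral_step_fixpoint T beta (2 * M) v u y x q Q) as [Hxb Ey]; auto;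
    try (intros n; apply Hbd).
  destruct (vanishing_primitive_mult_spec _ y r P HrP Hyc Hyb) as [F1 F2].
  destruct (vanishing_primitive_mult_spec _ x q Q HqQ Hxc Hxb) as [G1 G2].
  (* Dropping the clamp makes the solution two-sided differentiable at [T]. *)
  exists T, (fun t => alpha + vanishing_primitive (fun s => r s * y s) t),
    (fun t => beta + vanishing_primitive (fun s => q s * x s) t).
  split; [apply HT|split; [|split]].
  - intros t Ht; split.
    + replace (beta + _) with (y t)
        by (rewrite Ey; unfold integral_step; rewrite Rmax_right by exact Ht; reflexivity).
      evar_last; [apply @is_derive_plus; [apply @is_derive_const | apply F1]|].
      unfold plus, zero; simpl; ring.
    + replace (alpha + _) with (x t)
        by (rewrite Ex; unfold integral_step; rewrite Rmax_right by exact Ht; reflexivity).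
      evar_last; [apply @is_derive_plus; [apply @is_derive_const | apply G1]|].
      unfold plus, zero; simpl; ring.
  - replace alpha with (alpha + 0) at 1 by ring.
    apply is_lim_plus'; [apply is_lim_const | exact F2].
  - replace beta with (beta + 0) at 1 by ring.
    apply is_lim_plus'; [apply is_lim_const | exact G2].
Qed.

(** * The terminal state of an arbitrary solution *)

Lemma solves_system_le (r q x y : R -> R) (T T' : R) :
  T <= T' -> solves_system r q T x y -> solves_system r q T' x y.
Proof. intros HT H t Ht; apply H; lra. Qed.

Lemma is_derive_Rmult (f g : R -> R) (t f' g' : R) :
  is_derive f t f' -> is_derive g t g' ->
  is_derive (fun s => f s * g s) t (f' * g t + f t * g').
Proof. intros Hf Hg; exact (is_derive_mult f g t f' g' Hf Hg Rmult_comm). Qed.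

Lemma wronskian_constant (r q x1 y1 x2 y2 : R -> R) (T t : R) :
  solves_system r q T x1 y1 -> solves_system r q T x2 y2 -> T <= t ->
  x1 t * y2 t - x2 t * y1 t = x1 T * y2 T - x2 T * y1 T.
Proof.
  intros H1 H2 Ht.
  assert (D : forall s, T <= s ->
            is_derive (fun s => x1 s * y2 s - x2 s * y1 s) s 0).
  { intros s Hs; destruct (H1 s Hs) as [A1 B1]; destruct (H2 s Hs) as [A2 B2].
    evar_last.
    - apply @is_derive_minus; apply is_derive_Rmult; eassumption.
    - unfold minus, plus, opp, mult; simpl; ring. }
  assert (D' : forall s, T <= s ->
            is_derive (fun s => - (x1 s * y2 s - x2 s * y1 s)) s 0).
  { intros s Hs; evar_last; [apply @is_derive_opp, D, Hs | apply Ropp_0]. }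
  assert (H0 : forall s, T <= s -> 0 <= 0) by (intros; lra).
  assert (K := nondecreasing_from T _ (fun _ => 0) T t D H0 (Rle_refl T) Ht).
  assert (K' := nondecreasing_from T _ (fun _ => 0) T t D' H0 (Rle_refl T) Ht).
  cbv beta in K, K'; lra.
Qed.

(** Every solution is a combination, with Wronskians as coefficients, of the two
    solutions with terminal states [(1, 0)] and [(0, 1)]. *)
Lemma solution_has_limits (r q P Q x y : R -> R) (T0 : R) :
  integrable_weight r P -> integrable_weight q Q -> solves_system r q T0 x y ->
  exists X Y : R, is_lim x p_infty X /\ is_lim y p_infty Y.
Proof.
  intros HrP HqQ Hxy.
  destruct (terminal_value_problem r q P Q 1 0 T0 HrP HqQ)
    as [T1 [x1 [y1 [HT1 [S1 [X1 Y1]]]]]].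
  destruct (terminal_value_problem r q P Q 0 1 T1 HrP HqQ)
    as [T [x2 [y2 [HT [S2 [X2 Y2]]]]]].
  apply (solves_system_le r q x1 y1 T1 T) in S1; [|lra].
  apply (solves_system_le r q x y T0 T) in Hxy; [|lra].
  set (c1 := x T * y2 T - x2 T * y T); set (c2 := x1 T * y T - x T * y1 T).
  assert (W : x1 T * y2 T - x2 T * y1 T = 1).
  { assert (L : is_lim (fun t => x1 t * y2 t - x2 t * y1 t) p_infty (1 * 1 - 0 * 0)).
    { apply is_lim_minus'; apply is_lim_mult_finite; assumption. }
    apply (is_lim_ext_loc _ (fun _ => x1 T * y2 T - x2 T * y1 T)), is_lim_unique in L.
    - rewrite Lim_const in L; injection L as L; lra.
    - exists T; intros t Ht; apply (wronskian_constant r q); auto; lra. }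
  assert (C : forall t, T <= t ->
            x t = c1 * x1 t + c2 * x2 t /\ y t = c1 * y1 t + c2 * y2 t).
  { intros t Ht.
    assert (W0 := wronskian_constant r q x1 y1 x2 y2 T t S1 S2 Ht); rewrite W in W0.
    assert (W1 := wronskian_constant r q x y x2 y2 T t Hxy S2 Ht).
    assert (W2 := wronskian_constant r q x1 y1 x y T t S1 Hxy Ht).
    unfold c1, c2; rewrite <- W1, <- W2; split.
    - transitivity (x t * (x1 t * y2 t - x2 t * y1 t)); [rewrite W0|]; ring.
    - transitivity (y t * (x1 t * y2 t - x2 t * y1 t)); [rewrite W0|]; ring. }
  exists (c1 * 1 + c2 * 0), (c1 * 0 + c2 * 1); split.
  - apply (is_lim_ext_loc (fun t => c1 * x1 t + c2 * x2 t)).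
    + exists T; intros t Ht; symmetry; apply C; lra.
    + apply is_lim_plus'; apply is_lim_mult_finite; auto; apply is_lim_const.
  - apply (is_lim_ext_loc (fun t => c1 * y1 t + c2 * y2 t)).
    + exists T; intros t Ht; symmetry; apply C; lra.
    + apply is_lim_plus'; apply is_lim_mult_finite; auto; apply is_lim_const.
Qed.

(** Uniqueness for the terminal value problem on the whole interval of
    definition: the derivative of [(x^2 + y^2) exp (- (P + Q))] is
    [(r + q) (x + y)^2 exp (- (P + Q))], so this function increases to [0]. *)
Lemma zero_terminal_state (r q P Q x y : R -> R) (T t : R) :
  integrable_weight r P -> integrable_weight q Q -> solves_system r q T x y ->
  is_lim x p_infty 0 -> is_lim y p_infty 0 -> T <= t -> x t = 0.
Proof.
  intros HrP HqQ Hxy Hx Hy Ht.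
  set (E := fun t => (x t * x t + y t * y t) * exp (- (P t + Q t))).
  assert (L : is_lim E p_infty ((0 * 0 + 0 * 0) * exp (- (0 + 0)))).
  { apply is_lim_mult_finite.
    - apply is_lim_plus'; apply is_lim_mult_finite; assumption.
    - apply (is_lim_comp_continuous (fun t => - (P t + Q t)) exp).
      + apply (is_lim_opp (fun t => P t + Q t) p_infty (Finite (0 + 0))).
        apply is_lim_plus'; [apply HrP | apply HqQ].
      + apply @ex_derive_continuous; auto_derive; auto. }
  assert (D : forall s, T <= s ->
            is_derive E s ((r s + q s) * (x s + y s) ^ 2 * exp (- (P s + Q s)))).
  { intros s Hs; destruct (Hxy s Hs) as [A B].
    assert (Ds : is_derive (fun s => exp (- (P s + Q s))) s
                   ((r s + q s) * exp (- (P s + Q s)))).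
    { evar_last.
      - apply (is_derive_comp exp (fun s => - (P s + Q s))).
        + apply is_derive_exp.
        + apply @is_derive_opp, @is_derive_plus; [apply HrP | apply HqQ].
      - unfold scal, opp, plus; simpl; unfold mult; simpl; ring. }
    unfold E; evar_last.
    - apply is_derive_Rmult; [| exact Ds].
      apply @is_derive_plus; apply is_derive_Rmult; eassumption.
    - unfold plus, mult; simpl; ring. }
  assert (H : E t <= 0).
  { assert (K := is_lim_le_loc (fun _ => E t) E p_infty (E t)
      ((0 * 0 + 0 * 0) * exp (- (0 + 0)))).
    simpl in K; replace 0 with ((0 * 0 + 0 * 0) * exp (- (0 + 0))) by ring.
    apply K; [|apply is_lim_const|exact L].
    exists t; intros s Hs.
    apply (nondecreasing_from T E _ t s D); try lra.
    intros u Hu; apply Rmult_le_pos; [|left; apply exp_pos].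
    apply Rmult_le_pos; [|apply pow2_ge_0].
    generalize (proj1 (proj2 HrP) u) (proj1 (proj2 HqQ) u); lra. }
  unfold E in H; assert (He := exp_pos (- (P t + Q t))).
  assert (x t * x t + y t * y t <= 0).
  { apply (Rmult_le_reg_r _ _ _ He); rewrite Rmult_0_l; exact H. }
  nra.
Qed.

(** * Improper integrals and the clamped weights *)

Lemma is_RInt_gen_primitive (f F : R -> R) (t l : R) :
  (forall s, t <= s -> is_derive F s (f s)) ->
  (forall s, t <= s -> continuous f s) ->
  is_lim F p_infty l ->
  is_RInt_gen f (at_point t) (Rbar_locally p_infty) (l - F t).
Proof.
  intros HF Hc Hl S HS.
  assert (L : is_lim (fun s => F s - F t) p_infty (l - F t))
    by (apply is_lim_minus'; [exact Hl | apply is_lim_const]).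
  specialize (L S HS).
  apply (Filter_prod _ _ _ (fun u => u = t) (fun s => t <= s /\ S (F s - F t))).
  - reflexivity.
  - apply filter_and; [apply eventually_ge | exact L].
  - intros u s -> [Hs HSs]; exists (F s - F t); split; [|exact HSs].
    apply (@is_RInt_derive R_CompleteNormedModule F f);
      simpl; rewrite Rmin_left by exact Hs; intros v Hv; [apply HF | apply Hc]; apply Hv.
Qed.

Lemma tail_integral_primitive (f F : R -> R) (t l : R) :
  (forall s, t <= s -> is_derive F s (f s)) ->
  (forall s, t <= s -> continuous f s) ->
  is_lim F p_infty l -> tail_integral f t = l - F t.
Proof.
  intros HF Hc Hl.
  exact (@is_RInt_gen_unique R_CompleteNormedModule _ _ _ _ f _
           (is_RInt_gen_primitive f F t l HF Hc Hl)).
Qed.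

Lemma continuous_clamp (f : R -> R) (a t : R) :
  continuous_on (fun s => a <= s) f -> continuous (fun s => f (Rmax a s)) t.
Proof.
  intros Hf S HS.
  assert (H := Hf (Rmax a t) (Rmax_l a t) S HS); unfold filtermap, within in H.
  assert (H' := continuous_Rmax_l a t _ H); unfold filtermap in *.
  revert H'; apply filter_imp; intros s Hs; apply Hs, Rmax_l.
Qed.

Lemma continuous_on_interior (f : R -> R) (a t : R) :
  continuous_on (fun s => a <= s) f -> a < t -> continuous f t.
Proof.
  intros Hf Ht; apply (continuous_ext_loc f (fun s => f (Rmax a s)) t).
  - apply (locally_interval _ t a p_infty Ht I); intros s Hs _.
    rewrite Rmax_right; [reflexivity | apply Rlt_le, Hs].
  - apply continuous_clamp, Hf.
Qed.

(** Clamping the argument to [[a,+oo)] extends the coefficients of the equation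
    to continuous functions on the whole line. *)
Lemma weight_of_improper (a : R) (f : R -> R) :
  continuous_on (fun t => a <= t) f -> (forall t, a <= t -> 0 < f t) ->
  improper_converges f a ->
  exists P, integrable_weight (fun t => f (Rmax a t)) P /\
    forall t, a < t -> tail_integral f t = P t.
Proof.
  intros Hc Hpos [l Hl].
  set (g := fun t => f (Rmax a t)); set (F := RInt g a).
  assert (Hg : forall t, continuous g t) by (intros; apply continuous_clamp, Hc).
  assert (HI : forall t, is_RInt g a t (F t)).
  { intros t; apply (@RInt_correct R_CompleteNormedModule).
    apply (@ex_RInt_continuous R_CompleteNormedModule); intros; apply Hg. }
  assert (HF : forall t, is_derive F t (g t)).
  { intros t; apply (is_derive_RInt g F a t); [|apply Hg].
    apply filter_forall, HI. }
  assert (HL : is_lim F p_infty l).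
  { intros S HS; destruct (Hl S HS) as [A B HA HB H].
    change (Rbar_locally p_infty (fun t => S (F t))).
    generalize (filter_and _ _ (eventually_ge a) HB); apply filter_imp.
    intros t [Ht HBt]; destruct (H a t HA HBt) as [y [Hy HSy]]; simpl in Hy.
    replace (F t) with y; [exact HSy|].
    rewrite <- (is_RInt_unique _ _ _ _ Hy); apply RInt_ext.
    rewrite Rmin_left by exact Ht; intros s Hs; unfold g.
    rewrite Rmax_right by lra; reflexivity. }
  exists (fun t => l - F t); split; [split; [|split; [|split]]|].
  - exact Hg.
  - intros t; left; apply Hpos, Rmax_l.
  - intros t; evar_last; [apply @is_derive_minus; [apply @is_derive_const | apply HF]|].
    unfold minus, plus, opp, zero; simpl; ring.
  - replace (Finite 0) with (Finite (l - l)) by (f_equal; ring).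
    apply is_lim_minus'; [apply is_lim_const | exact HL].
  - intros t Ht; apply tail_integral_primitive; [| |exact HL].
    + intros s Hs; generalize (HF s); unfold g; rewrite Rmax_right by lra; auto.
    + intros s Hs; apply (continuous_on_interior f a); [exact Hc | lra].
Qed.

(** * Derivatives on a half-line *)

Lemma is_derive_from_of_is_derive (T t l : R) (f : R -> R) :
  T <= t -> is_derive f t l -> is_derive_from T f t l.
Proof.
  intros Ht [Hlin Hd]; split; [exact Hlin|]; intros x Hx.
  assert (E : x = t).
  { apply (@eq_close R_AbsRing R_NormedModule); intros eps.
    exact (locally_singleton t _ (Hx _ (locally_ball x eps)) Ht). }
  subst x; intros eps; apply filter_le_within.
  exact (Hd t (fun P HP => HP) eps).
Qed.

Lemma is_derive_of_is_derive_from (T t l : R) (f : R -> R) :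
  T < t -> is_derive_from T f t l -> is_derive f t l.
Proof.
  intros Ht [Hlin Hd]; split; [exact Hlin|]; intros x Hx eps.
  assert (H : within (fun s => T <= s) (locally t)
    (fun s => norm (minus (minus (f s) (f x)) (scal (minus s x) l))
              <= eps * norm (minus s x))).
  { apply (Hd x); intros S HS; apply filter_le_within.
    exact (Hx S HS). }
  assert (N := locally_interval (fun s => T <= s) t T p_infty Ht I
                 (fun s Hs _ => Rlt_le _ _ Hs)).
  unfold within in H; generalize (filter_and (F := locally t) _ _ H N).
  apply filter_imp; intros s [K Hs]; exact (K Hs).
Qed.

(** At the left endpoint a solution is only differentiable from the right; this
    moves a point where it does not vanish to the interior. *)
Lemma nonzero_after_start (T l : R) (f : R -> R) :
  is_derive_from T f T l -> f T <> 0 -> exists t, T < t /\ f t <> 0.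
Proof.
  intros Hf H0.
  assert (C : filterlim f (within (fun s => T <= s) (locally T)) (locally (f T))).
  { apply (@filterdiff_continuous_aux R_AbsRing R_NormedModule R_NormedModule).
    - apply within_filter, locally_filter.
    - eexists; exact Hf.
    - intros S HS; apply filter_le_within; exact HS. }
  assert (N : locally (f T) (fun v => v <> 0)) by (apply open_neq, H0).
  destruct (C _ N) as [eps He]; exists (T + eps / 2).
  destruct eps as [eps Heps]; simpl in *; split; [lra|].
  apply He; [|lra].
  change (Rabs (T + eps / 2 - T) < eps); rewrite Rabs_pos_eq; lra.
Qed.

(** * Types of terminal states *)

Lemma finite_nonzero_Finite (l : R) : finite_nonzero l <-> l <> 0.
Proof.
  unfold finite_nonzero; simpl; split.
  - intros [H _] ->; rewrite Rabs_R0 in H; lra.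
  - intros H; split; [apply Rabs_pos_lt, H | exact I].
Qed.

Lemma terminal_state_unique (p x : R -> R) (X Y : R) (X' Y' : Rbar) :
  terminal_state p x X Y -> terminal_state p x X' Y' -> X' = X /\ Y' = Y.
Proof.
  intros [H1 H2] [H3 H4]; apply is_lim_unique in H1, H2, H3, H4; split; congruence.
Qed.

Lemma type_III_iff (p x : R -> R) (X Y : R) :
  terminal_state p x X Y ->
  (type_III_i p x <-> X <> 0 /\ Y <> 0) /\
  (type_III_ii p x <-> X = 0 /\ Y <> 0) /\
  (type_III_iii p x <-> X <> 0 /\ Y = 0).
Proof.
  intros H; rewrite <- !finite_nonzero_Finite.
  split; [|split]; split;
    try (intros (X' & Y' & H' & HX & HY);
         destruct (terminal_state_unique p x X Y X' Y' H H') as [-> ->];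
         split; (assumption || congruence));
    intros [HX HY]; exists X, Y; (split; [exact H|]); split; (assumption || congruence).
Qed.

(** * Recovering a function from its logarithmic derivative *)

Lemma ratio_pos_nonzero (z Z : R) : 0 < z / Z -> z <> 0.
Proof. intros H ->; unfold Rdiv in H; lra. Qed.

Lemma ratio_eventually_pos (z : R -> R) (Z : R) :
  is_lim z p_infty Z -> Z <> 0 -> Rbar_locally p_infty (fun t => 0 < z t / Z).
Proof.
  intros HL HZ; apply (is_lim_eventually_pos _ 1); [|lra].
  replace (Finite 1) with (Finite (Z / Z)) by (f_equal; field; exact HZ).
  apply is_lim_div_finite; [exact HL | apply is_lim_const | exact HZ].
Qed.

Lemma is_lim_nonzero (f : R -> R) (l : R) :
  is_lim f p_infty l -> l <> 0 -> Rbar_locally p_infty (fun t => f t <> 0).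
Proof.
  intros Hf Hl; generalize (ratio_eventually_pos f l Hf Hl).
  apply filter_imp; intros t; apply ratio_pos_nonzero.
Qed.

Lemma asymptotic_const (f : R -> R) (l : R) :
  l <> 0 -> is_lim f p_infty l -> asymptotic f (fun _ => l).
Proof.
  intros Hl Hf; unfold asymptotic.
  replace (Finite 1) with (Finite (l / l)) by (f_equal; field; exact Hl).
  apply is_lim_div_finite; [exact Hf | apply is_lim_const | exact Hl].
Qed.

Lemma continuous_div (f g : R -> R) (t : R) :
  continuous f t -> continuous g t -> g t <> 0 -> continuous (fun s => f s / g s) t.
Proof.
  intros Hf Hg H0; apply (continuous_mult f (fun s => / g s)); [exact Hf|].
  apply continuous_Rinv_comp; assumption.
Qed.

(** A function whose limit is finite and nonzero is recovered from its
    logarithmic derivative [g], because [ln (z / Z)] is the primitive of [g]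
    that vanishes at infinity. *)
Lemma is_exp_integral_log_derivative (T Z : R) (g z : R -> R) :
  Z <> 0 -> (forall t, T <= t -> is_derive z t (g t * z t)) ->
  (forall t, T <= t -> continuous g t) ->
  (forall t, T <= t -> 0 < z t / Z) ->
  is_lim z p_infty Z -> is_exp_integral g T (fun t => z t / Z).
Proof.
  intros HZ Hz Hg Hpos HL.
  set (F := fun t => ln (z t / Z)).
  assert (HF : forall t, T <= t -> is_derive F t (g t)).
  { intros t Ht; unfold F; evar_last.
    - apply (is_derive_comp ln (fun t => z t / Z)).
      + apply is_derive_ln, Hpos, Ht.
      + apply (is_derive_Rmult z (fun _ => / Z)); [apply Hz, Ht | apply @is_derive_const].
    - unfold scal, zero; simpl; unfold mult; simpl.
      assert (z t <> 0).
      { intros E; generalize (Hpos t Ht); rewrite E; unfold Rdiv; lra. }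
      field; auto. }
  assert (L : is_lim F p_infty 0).
  { rewrite <- ln_1; replace 1 with (Z / Z) by (field; exact HZ).
    apply (is_lim_comp_continuous (fun t => z t / Z) ln).
    - apply is_lim_div_finite; [exact HL | apply is_lim_const | exact HZ].
    - apply @ex_derive_continuous; eexists; apply is_derive_ln.
      replace (Z / Z) with 1 by (field; exact HZ); lra. }
  right; split.
  - eexists; apply (is_RInt_gen_primitive g F T 0); auto.
  - intros t Ht; rewrite (tail_integral_primitive g F t 0); [| | |exact L];
      try (intros s Hs; first [apply HF | apply Hg]; lra).
    replace (- (0 - F t)) with (F t) by ring.
    unfold F; rewrite exp_ln; [reflexivity | apply Hpos, Ht].
Qed.

(** * The equation as a first order system *)

Section Equation.

Context (a : R) (p q P Q : R -> R)
  (p_pos : forall t, a <= t -> 0 < p t) (q_pos : forall t, a <= t -> 0 < q t)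
  (p_cont : continuous_on (fun t => a <= t) p)
  (q_cont : continuous_on (fun t => a <= t) q).

Let r0 (t : R) : R := 1 / p (Rmax a t).
Let q0 (t : R) : R := q (Rmax a t).

Context (HP : integrable_weight r0 P) (HQ : integrable_weight q0 Q).

Lemma solves_system_of_solves_A (T T' : R) (x x' : R -> R) :
  a <= T -> T < T' ->
  (forall t, T <= t -> is_derive_from T x t (x' t) /\
                       is_derive_from T (fun s => p s * x' s) t (q t * x t)) ->
  solves_system r0 q0 T' x (fun t => p t * x' t).
Proof.
  intros HT HT' H t Ht; unfold r0, q0; rewrite Rmax_right by lra.
  destruct (H t ltac:(lra)) as [H1 H2]; split.
  - replace (1 / p t * (p t * x' t)) with (x' t)
      by (field; apply Rgt_not_eq, p_pos; lra).
    apply (is_derive_of_is_derive_from T); [lra | exact H1].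
  - apply (is_derive_of_is_derive_from T); [lra | exact H2].
Qed.

Lemma quasi_derivative_eventually (T : R) (x y : R -> R) :
  solves_system r0 q0 T x y ->
  Rbar_locally p_infty (fun t => y t = quasi_derivative p x t).
Proof.
  intros H; generalize (filter_and _ _ (eventually_ge T) (eventually_ge a)).
  apply filter_imp; intros t [Ht Hat].
  destruct (H t Ht) as [H1 _]; unfold quasi_derivative.
  rewrite (is_derive_unique _ _ _ H1); unfold r0; rewrite Rmax_right by exact Hat.
  field; apply Rgt_not_eq, p_pos, Hat.
Qed.

Lemma solution_terminal_state (x : R -> R) :
  solution_A a p q x ->
  exists X Y : R, terminal_state p x X Y /\ ~ (X = 0 /\ Y = 0).
Proof.
  intros (T & HT & [x' Hx'] & t0 & Ht0 & Hxt0).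
  assert (S := fun T' h => solves_system_of_solves_A T T' x x' HT h Hx').
  destruct (solution_has_limits r0 q0 P Q x (fun t => p t * x' t) (T + 1) HP HQ)
    as [X [Y [LX LY]]]; [apply S; lra|].
  exists X, Y; split; [split|].
  - exact LX.
  - apply (is_lim_ext_loc (fun t => p t * x' t)); [|exact LY].
    apply (quasi_derivative_eventually (T + 1)), S; lra.
  - intros [-> ->].
    assert (N : exists t, T < t /\ x t <> 0).
    { destruct (Rle_lt_or_eq_dec _ _ Ht0) as [h|<-]; [exists t0; auto|].
      apply (nonzero_after_start T (x' T)); [apply Hx', Ht0 | exact Hxt0]. }
    destruct N as [t1 [Ht1 Hx1]]; apply Hx1.
    exact (zero_terminal_state r0 q0 P Q x _ t1 t1 HP HQ (S t1 Ht1) LX LY (Rle_refl t1)).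
Qed.

Lemma solution_A_of_system (T : R) (x y : R -> R) :
  a <= T -> solves_system r0 q0 T x y ->
  Rbar_locally p_infty (fun t => x t <> 0) -> solution_A a p q x.
Proof.
  intros HT H Hx.
  (* Starting after [T] leaves room for the clamped coefficients to agree with the
     given ones on both sides of the starting point. *)
  exists (T + 1); split; [lra|]; split.
  - exists (fun t => 1 / p t * y t); intros t Ht.
    destruct (H t ltac:(lra)) as [H1 H2]; unfold r0, q0 in H1, H2.
    rewrite Rmax_right in H1, H2 by lra.
    split; apply is_derive_from_of_is_derive; auto.
    apply (is_derive_ext_loc y); [|exact H2].
    apply (locally_interval _ t T p_infty); [simpl; lra | exact I|].
    intros s Hs _; simpl in Hs; change (y s = p s * (1 / p s * y s) :> R).
    field; apply Rgt_not_eq, p_pos; lra.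
  - destruct (filter_ex _ (filter_and _ _ (eventually_ge (T + 1)) Hx)) as [t Ht].
    exists t; exact Ht.
Qed.

(** * Reproduction from the Riccati equations *)

Lemma system_continuous (T t : R) (x y : R -> R) :
  solves_system r0 q0 T x y -> T <= t -> continuous x t /\ continuous y t.
Proof.
  intros H Ht; destruct (H t Ht) as [H1 H2].
  split; apply @ex_derive_continuous; eexists; eassumption.
Qed.

(** Here [u = y / x], and [u / p] is the logarithmic derivative of [x]. *)
Lemma reproduced_from_R1_of_nonzero_limit (T X : R) (x y : R -> R) :
  solves_system r0 q0 T x y -> is_lim x p_infty X -> X <> 0 ->
  reproduced_from_R1 a p q x.
Proof.
  intros H LX HX.
  destruct (filter_and _ _ (ratio_eventually_pos x X LX HX)
              (filter_and _ _ (eventually_ge T) (eventually_ge a))) as [M HM].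
  set (T' := M + 1).
  assert (K : forall t, T' <= t -> 0 < x t / X /\ x t <> 0 /\ T <= t /\ a < t).
  { intros t Ht; destruct (HM t) as [H1 [H2 _]]; [unfold T' in Ht; lra|].
    (* Used at a point before [t], [HM] gives the strict inequality [a < t]. *)
    destruct (HM ((M + t) / 2)) as [_ [_ H3]]; [unfold T' in Ht; lra|].
    split; [|split; [|split]]; auto; [exact (ratio_pos_nonzero _ _ H1)|].
    unfold T' in Ht; lra. }
  exists T', (fun t => y t / x t), (fun t => x t / X); split; [|split].
  - left; apply K; lra.
  - intros t Ht; apply is_derive_from_of_is_derive; [exact Ht|].
    destruct (K t Ht) as (_ & Hx & HT & Ha); destruct (H t HT) as [H1 H2].
    unfold r0, q0 in H1, H2; rewrite Rmax_right in H1, H2 by lra.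
    assert (Hp := Rgt_not_eq _ _ (p_pos t ltac:(lra))).
    evar_last; [apply is_derive_div; eassumption|]; field; auto.
  - left; split.
    + apply is_exp_integral_log_derivative; auto.
      * intros t Ht; destruct (K t Ht) as (_ & Hx & HT & Ha).
        destruct (H t HT) as [H1 _]; unfold r0 in H1; rewrite Rmax_right in H1 by lra.
        assert (Hp := Rgt_not_eq _ _ (p_pos t ltac:(lra))).
        evar_last; [exact H1|]; field; auto.
      * intros t Ht; destruct (K t Ht) as (_ & Hx & HT & Ha).
        destruct (system_continuous T t x y H HT) as [Cx Cy].
        apply continuous_div; [apply continuous_div; assumption | |].
        -- apply (continuous_on_interior p a); assumption.
        -- apply Rgt_not_eq, p_pos; lra.
      * intros t Ht; apply K, Ht.
    + exists X; split; [exact HX|].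
      exists M; intros t Ht; field; exact HX.
Qed.

(** Here [v = x / y], and [q v] is the logarithmic derivative of [y]; [x] itself
    may tend to [0]. *)
Lemma reproduced_from_R2_of_nonzero_limit (T Y : R) (x y : R -> R) :
  solves_system r0 q0 T x y -> is_lim y p_infty Y -> Y <> 0 ->
  Rbar_locally p_infty (fun t => x t <> 0) ->
  reproduced_from_R2 a p q x.
Proof.
  intros H LY HY Hx0.
  destruct (filter_and _ _ (filter_and _ _ (ratio_eventually_pos y Y LY HY) Hx0)
              (filter_and _ _ (eventually_ge T) (eventually_ge a))) as [M HM].
  set (T' := M + 1).
  assert (K : forall t, T' <= t ->
            0 < y t / Y /\ y t <> 0 /\ x t <> 0 /\ T <= t /\ a < t).
  { intros t Ht; destruct (HM t) as [[H1 Hx] [H2 _]]; [unfold T' in Ht; lra|].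
    (* Used at a point before [t], [HM] gives the strict inequality [a < t]. *)
    destruct (HM ((M + t) / 2)) as [_ [_ H3]]; [unfold T' in Ht; lra|].
    repeat split; auto; [exact (ratio_pos_nonzero _ _ H1)|].
    unfold T' in Ht; lra. }
  exists T', (fun t => x t / y t), (fun t => y t / Y); split; [|split; [|split]].
  - left; apply K; lra.
  - intros t Ht; apply is_derive_from_of_is_derive; [exact Ht|].
    destruct (K t Ht) as (_ & Hy & _ & HT & Ha); destruct (H t HT) as [H1 H2].
    unfold r0, q0 in H1, H2; rewrite Rmax_right in H1, H2 by lra.
    assert (Hp := Rgt_not_eq _ _ (p_pos t ltac:(lra))).
    evar_last; [apply is_derive_div; eassumption|]; field; auto.
  - intros t Ht; destruct (K t Ht) as (_ & Hy & Hx & _ & _).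
    apply Rmult_integral_contrapositive_currified; [exact Hx | apply Rinv_neq_0_compat, Hy].
  - right; split.
    + apply is_exp_integral_log_derivative; auto.
      * intros t Ht; destruct (K t Ht) as (_ & Hy & Hx & HT & Ha).
        destruct (H t HT) as [_ H2]; unfold q0 in H2; rewrite Rmax_right in H2 by lra.
        evar_last; [exact H2|]; field; exact Hy.
      * intros t Ht; destruct (K t Ht) as (_ & Hy & Hx & HT & Ha).
        destruct (system_continuous T t x y H HT) as [Cx Cy].
        apply (continuous_mult q (fun t => x t / y t)); [|apply continuous_div; assumption].
        apply (continuous_on_interior q a); assumption.
      * intros t Ht; apply K, Ht.
    + exists Y; split; [exact HY|].
      exists (M + 1); intros t Ht; field; split; [exact HY | apply K; unfold T'; lra].
Qed.

(** * Representatives of the three types *)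

Lemma solution_type_trichotomy (x : R -> R) :
  solution_A a p q x ->
  (type_III_i p x /\ ~ type_III_ii p x /\ ~ type_III_iii p x) \/
  (~ type_III_i p x /\ type_III_ii p x /\ ~ type_III_iii p x) \/
  (~ type_III_i p x /\ ~ type_III_ii p x /\ type_III_iii p x).
Proof.
  intros Hx; destruct (solution_terminal_state x Hx) as [X [Y [H0 N]]].
  destruct (type_III_iff p x X Y H0) as [-> [-> ->]].
  destruct (Req_dec X 0); destruct (Req_dec Y 0); tauto.
Qed.

Lemma solution_with_terminal_state (X Y : R) :
  exists T x y, a <= T /\ solves_system r0 q0 T x y /\
    is_lim x p_infty X /\ is_lim y p_infty Y /\ terminal_state p x X Y.
Proof.
  destruct (terminal_value_problem r0 q0 P Q X Y a HP HQ) as (T & x & y & HT & S & LX & LY).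
  exists T, x, y; split; [exact HT|split; [exact S|split; [exact LX|split; [exact LY|]]]].
  split; [exact LX|].
  apply (is_lim_ext_loc y); [apply (quasi_derivative_eventually T), S | exact LY].
Qed.

Lemma representative_III_i :
  exists x, solution_A a p q x /\ type_III_i p x /\
    (reproduced_from_R1 a p q x \/ reproduced_from_R2 a p q x) /\
    asymptotic x (fun _ => 1) /\ asymptotic (quasi_derivative p x) (fun _ => 1).
Proof.
  destruct (solution_with_terminal_state 1 1) as (T & x & y & HT & S & LX & LY & TS).
  assert (H1 : 1 <> 0) by lra.
  exists x; split; [|split; [|split; [|split]]].
  - exact (solution_A_of_system T x y HT S (is_lim_nonzero x 1 LX H1)).
  - apply (type_III_iff p x 1 1 TS); auto.
  - left; exact (reproduced_from_R1_of_nonzero_limit T 1 x y S LX H1).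
  - apply asymptotic_const, LX; exact H1.
  - apply asymptotic_const, TS; exact H1.
Qed.

Lemma representative_III_ii :
  exists x, solution_A a p q x /\ type_III_ii p x /\
    (reproduced_from_R1 a p q x \/ reproduced_from_R2 a p q x) /\
    is_lim (fun t => x t / P t) p_infty 1 /\
    asymptotic (quasi_derivative p x) (fun _ => -1).
Proof.
  destruct (solution_with_terminal_state 0 (-1)) as (T & x & y & HT & S & LX & LY & TS).
  assert (H1 : -1 <> 0) by lra.
  assert (LP : is_lim (fun t => x t / P t) p_infty 1).
  { replace 1 with (- -1) by ring.
    apply (vanishing_quotient T (-1) x y r0 P HP); auto.
    - intros s; unfold r0; apply Rdiv_lt_0_compat; [lra | apply p_pos, Rmax_l].
    - intros t Ht; apply S, Ht. }
  assert (Hx : Rbar_locally p_infty (fun t => x t <> 0)).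
  { generalize (is_lim_nonzero _ 1 LP ltac:(lra)).
    apply filter_imp; intros t Ht E; apply Ht; rewrite E; unfold Rdiv; ring. }
  exists x; split; [|split; [|split; [|split]]].
  - exact (solution_A_of_system T x y HT S Hx).
  - apply (type_III_iff p x 0 (-1) TS); auto.
  - right; exact (reproduced_from_R2_of_nonzero_limit T (-1) x y S LY H1 Hx).
  - exact LP.
  - apply asymptotic_const, TS; exact H1.
Qed.

Lemma representative_III_iii :
  exists x, solution_A a p q x /\ type_III_iii p x /\
    (reproduced_from_R1 a p q x \/ reproduced_from_R2 a p q x) /\
    asymptotic x (fun _ => 1) /\
    is_lim (fun t => quasi_derivative p x t / Q t) p_infty (-1).
Proof.
  destruct (solution_with_terminal_state 1 0) as (T & x & y & HT & S & LX & LY & TS).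
  assert (H1 : 1 <> 0) by lra.
  exists x; split; [|split; [|split; [|split]]].
  - exact (solution_A_of_system T x y HT S (is_lim_nonzero x 1 LX H1)).
  - apply (type_III_iff p x 1 0 TS); auto.
  - left; exact (reproduced_from_R1_of_nonzero_limit T 1 x y S LX H1).
  - apply asymptotic_const, LX; exact H1.
  - apply (is_lim_ext_loc (fun t => y t / Q t)).
    + destruct (quasi_derivative_eventually T x y S) as [M HM].
      exists M; intros t Ht; rewrite (HM t Ht); reflexivity.
    + apply (vanishing_quotient T 1 y x q0 Q HQ); auto.
      * intros s; apply q_pos, Rmax_l.
      * intros t Ht; apply S, Ht.
Qed.

End Equation.

Theorem theorem3p4 (a : R) (p q : R -> R)
  (ha : 0 <= a)
  (p_pos : forall t, a <= t -> 0 < p t)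
  (q_pos : forall t, a <= t -> 0 < q t)
  (p_cont : continuous_on (fun t => a <= t) p)
  (q_cont : continuous_on (fun t => a <= t) q)
  (p_int : improper_converges (fun t => 1 / p t) a)
  (q_int : improper_converges q a) :
  let pi := tail_integral (fun s => 1 / p s) in
  let rho := tail_integral q in
  (forall x : R -> R, solution_A a p q x ->
     (type_III_i p x /\ ~ type_III_ii p x /\ ~ type_III_iii p x) \/
     (~ type_III_i p x /\ type_III_ii p x /\ ~ type_III_iii p x) \/
     (~ type_III_i p x /\ ~ type_III_ii p x /\ type_III_iii p x)) /\
  (exists x1 x2 x3 : R -> R,
     (solution_A a p q x1 /\ type_III_i p x1 /\
      (reproduced_from_R1 a p q x1 \/ reproduced_from_R2 a p q x1) /\
      asymptotic x1 (fun _ => 1) /\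
      asymptotic (quasi_derivative p x1) (fun _ => 1)) /\
     (solution_A a p q x2 /\ type_III_ii p x2 /\
      (reproduced_from_R1 a p q x2 \/ reproduced_from_R2 a p q x2) /\
      asymptotic x2 pi /\
      asymptotic (quasi_derivative p x2) (fun _ => -1)) /\
     (solution_A a p q x3 /\ type_III_iii p x3 /\
      (reproduced_from_R1 a p q x3 \/ reproduced_from_R2 a p q x3) /\
      asymptotic x3 (fun _ => 1) /\
      asymptotic (quasi_derivative p x3) (fun t => - rho t))).
Proof.
  intros pi rho.
  assert (r_pos : forall t, a <= t -> 0 < 1 / p t).
  { intros t Ht; apply Rdiv_lt_0_compat; [lra | apply p_pos, Ht]. }
  assert (r_cont : continuous_on (fun t => a <= t) (fun t => 1 / p t)).
  { intros t Ht; apply (filterlim_comp _ _ _ p (fun v => 1 / v) _ _ _ (p_cont t Ht)).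
    apply @ex_derive_continuous; auto_derive; apply Rgt_not_eq, p_pos, Ht. }
  destruct (weight_of_improper a _ r_cont r_pos p_int) as [P [HP EP]].
  change (forall t, a < t -> pi t = P t) in EP.
  destruct (weight_of_improper a q q_cont q_pos q_int) as [Q [HQ EQ]].
  change (forall t, a < t -> rho t = Q t) in EQ.
  split; [intros x; apply (solution_type_trichotomy a p q P Q p_pos HP HQ)|].
  destruct (representative_III_i a p q P Q p_pos p_cont HP HQ) as [x1 H1].
  destruct (representative_III_ii a p q P Q p_pos q_cont HP HQ)
    as (x2 & A2 & B2 & C2 & D2 & E2).
  destruct (representative_III_iii a p q P Q p_pos q_pos p_cont HP HQ)
    as (x3 & A3 & B3 & C3 & D3 & E3).
  exists x1, x2, x3; split; [exact H1|split; repeat split; auto].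
  - apply (is_lim_ext_loc (fun t => x2 t / P t)); [|exact D2].
    exists a; intros t Ht; rewrite (EP t Ht); reflexivity.
  - apply (is_lim_ext_loc (fun t => -1 * (quasi_derivative p x3 t / Q t))).
    + exists a; intros t Ht; rewrite (EQ t Ht).
      field; apply Rgt_not_eq, (weight_tail_pos _ Q t HQ).
      intros s; apply q_pos, Rmax_l.
    + replace 1 with (-1 * -1) by ring.
      apply (is_lim_scal_l _ (-1) p_infty (-1)), E3.
Qed.
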